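(* Let $\mathbb{X}_{\mathrm{F}}$ be the $(\times2,\times3)$-shift with its Haar probability measure $\mu_{\mathrm{F}}$. For $w\in\mathbb{X}_{\mathrm{F}}$, let $\omega=\omega_w=\sum_{x\in\mathbb{Z}^2} w_x\,\delta_x$ be the attached complex-valued Dirac comb, regarded as a measure on $\mathbb{R}^2$. Then, for $\mu_{\mathrm{F}}$-almost every $w\in\mathbb{X}_{\mathrm{F}}$, the autocorrelation measure $\gamma$ of $\omega$ exists, and the autocorrelation and diffraction measures of $\omega$ are $$\gamma=\delta_0\quad\text{and}\quad \widehat{\gamma}=\lambda,$$ where $\lambda$ denotes Lebesgue measure on $\mathbb{R}^2$.
   Context: Let $e_1,e_2$ be the standard unit vectors of $\mathbb{Z}^2\subset\mathbb{R}^2$ and $\mathbb{S}^1=\{z\in\mathbb{C}\mid |z|=1\}$. The $(\times2,\times3)$-shift (written multiplicatively) is $$\mathbb{X}_{\mathrm{F}}=\{w\in(\mathbb{S}^1)^{\mathbb{Z}^2}\mid w_{z+e_1}=w_z^2,\ w_{z+e_2}=w_z^3\text{ for all }z\in\mathbb{Z}^2\},$$ a closed subgroup (under pointwise multiplication) of the compact Abelian group $(\mathbb{S}^1)^{\mathbb{Z}^2}$ with the product topology; $\mu_{\mathrm{F}}$ is its normalised Haar measure, which is invariant and ergodic for the $\mathbb{Z}^2$ shift action $(\alpha^z(w))_x=w_{x+z}$. For $N\in\mathbb{N}$ let $C_N=[-N,N]^2\subset\mathbb{R}^2$. For a translation bounded measure $\omega$ on $\mathbb{R}^2$, let $\omega_N$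 be its restriction to $C_N$. For a measure $\nu$, let $\widetilde{\nu}(g)=\overline{\nu(\widetilde{g})}$ for continuous compactly supported $g$, where $\widetilde{g}(x)=\overline{g(-x)}$. The autocorrelation of $\omega$ is the vague limit $$\gamma=\lim_{N\to\infty}\frac{\omega_N*\widetilde{\omega_N}}{\mathrm{vol}(C_N)},$$ provided that the limit exists. It is then a positive definite measure, hence Fourier transformable, and its Fourier transform $\widehat{\gamma}$ (as a measure on $\mathbb{R}^2$, with the convention $\widehat{g}(k)=\int e^{-2\pi i k\cdot x}g(x)\,dx$, so that $\widehat{\delta_0}=\lambda$ and $\widehat{\delta_{\mathbb{Z}^2}}=\delta_{\mathbb{Z}^2}$) is called the diffraction measure of $\omega$. *)

(* Defs.v *)
From HB Require Import structures.
From mathcomp Require Import all_boot all_order all_algebra.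
From mathcomp Require Import all_classical all_reals all_analysis.
From mathcomp Require Import complex.
Set Implicit Arguments.
Unset Strict Implicit.
Unset Printing Implicit Defensive.
Import Order.TTheory GRing.Theory Num.Theory.
Import numFieldNormedType.Exports.
Local Open Scope classical_set_scope.
Local Open Scope ring_scope.
Local Open Scope complex_scope.

(* R[i] carries no topology of its own: its usual (norm) topology lives on the
   alias R[i]^o, which is used wherever continuity or convergence is meant. *)

Definition furst (R : realType) : set {ptws (int * int)%type -> R[i]^o} :=
  [set w | (forall z, `|w z : R[i]| = 1) /\
           forall z, w (z.1 + 1, z.2) = (w z : R[i]) ^+ 2 /\
                     w (z.1, z.2 + 1) = (w z : R[i]) ^+ 3].

(* The subspace topology is the one put by the library on set_type. *)
Definition furst_shift (R : realType) : Type := set_type (@furst R).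

HB.instance Definition _ (R : realType) :=
  Topological.copy (furst_shift R) (set_type (@furst R)).

Lemma furst1 (R : realType) : (fun=> 1) \in @furst R.
Proof.
by apply/mem_set; split=> [z|z]; rewrite ?normr1 ?expr1n.
Qed.

HB.instance Definition _ (R : realType) :=
  isPointed.Build (furst_shift R) (exist (fun w => w \in @furst R) _ (furst1 R)).

Lemma furstM (R : realType) (u v : furst_shift R) :
  (fun z => (val u z : R[i]) * val v z) \in @furst R.
Proof.
apply/mem_set; case: u v => [u /= /set_mem[u1 uX]] [v /= /set_mem[v1 vX]].
split=> [z|z]; first by rewrite normrM u1 v1 mulr1.
by have [-> ->] := uX z; have [-> ->] := vX z; rewrite !exprMn.
Qed.

Definition furst_mul (R : realType) (u v : furst_shift R) : furst_shift R :=
  exist (fun w => w \in @furst R) _ (furstM u v).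

Definition furst_borel (R : realType) :=
  g_sigma_algebraType (@open (furst_shift R)).

(* By uniqueness of Haar measure at most one probability satisfies this;
   regularity is automatic, the group being compact and metrisable. *)
Definition is_haar (R : realType) (mu : probability (furst_borel R) R) :=
  forall (u : furst_shift R) (A : set (furst_borel R)), measurable A ->
    mu [set furst_mul u v | v in A] = mu A.

(* (Possibly unbounded) complex measures on the plane are given by integration
   g |-> nu(g), i.e. as linear functionals in the Riesz-Markov sense. Values are
   allowed on functions outside C_c so that a measure can be restricted to a
   closed set. *)
Definition cmeas (R : realType) : Type := (R * R -> R[i]) -> R[i].

Definition Cc (R : realType) (g : R * R -> R[i]) : Prop :=
  continuous (g : R * R -> R[i]^o) /\ compact (closure [set x | g x != 0]).

Definition is_radon (R : realType) (nu : cmeas R) : Prop :=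
  (forall (a : R[i]) f g, Cc f -> Cc g ->
     nu (fun x => a * f x + g x) = a * nu f + nu g) /\
  (forall K : set (R * R), compact K -> exists M : R,
     forall f (s : R), Cc f -> (forall x, ~ K x -> f x = 0) ->
       (forall x, `|f x| <= s%:C) -> `|nu f| <= (M * s)%:C).

Definition delta (R : realType) (x : R * R) : cmeas R := fun g => g x.

(* The sum over Z^2 is a finite-support sum: it is only meaningful on functions
   of bounded support, the only ones to which it is applied below. *)
Definition dirac_comb (R : realType) (w : int * int -> R[i]) : cmeas R :=
  fun g => \sum_(z \in [set: int * int])
    w z * delta (z.1%:~R, z.2%:~R) g.

Definition omega (R : realType) (w : furst_shift R) : cmeas R :=
  dirac_comb (val w).

Definition restr (R : realType) (nu : cmeas R) (A : set (R * R)) : cmeas R :=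
  fun g => nu (fun x => \1_A x * g x).

Definition tilde (R : realType) (nu : cmeas R) : cmeas R :=
  fun g => Num.conj (nu (fun x => Num.conj (g (- x)))).

Definition mconv (R : realType) (mu nu : cmeas R) : cmeas R :=
  fun g => mu (fun x => nu (fun y => g (x + y))).

(* measurableTypeR R is R with the Borel sigma-algebra, the domain of the
   library's lebesgue_measure. *)
Notation plane R := (measurableTypeR R * measurableTypeR R)%type.

Definition lebesgue2 (R : realType) : {measure set (plane R) -> \bar R} :=
  (@lebesgue_measure R \x @lebesgue_measure R)%E.

Definition box (R : realType) (N : nat) : set (R * R) :=
  `[- N%:R, N%:R] `*` `[- N%:R, N%:R].

Definition is_autocorrelation (R : realType) (om gamma : cmeas R) : Prop :=
  is_radon gamma /\
  forall g, Cc g ->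
    (fun N : nat => let omN := restr om (@box R N) in
       mconv omN (tilde omN) g / (fine (lebesgue2 R (box N)))%:C : R[i]^o)
      @ \oo --> (gamma g : R[i]^o).

Definition cintegrable (R : realType) (nu : {measure set (plane R) -> \bar R})
    (g : R * R -> R[i]) : Prop :=
  nu.-integrable setT (fun x => (complex.Re (g x))%:E) /\
  nu.-integrable setT (fun x => (complex.Im (g x))%:E).

Definition cintegral (R : realType) (nu : {measure set (plane R) -> \bar R})
    (g : R * R -> R[i]) : R[i] :=
  Rintegral nu setT (fun x => complex.Re (g x)) +i*
  Rintegral nu setT (fun x => complex.Im (g x)).

Definition cis (R : realType) (t : R) : R[i] := cos t +i* sin t.

Definition fourier (R : realType) (g : R * R -> R[i]) : R * R -> R[i] :=
  fun k => cintegral (lebesgue2 R)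
    (fun x => cis (- (2 * pi * (k.1 * x.1 + k.2 * x.2))) * g x).

(* The transform of a measure is defined by duality, nu(g) = gamma(g^). By
   Fourier inversion the test functions g are the inverse transforms of those
   f in C_c whose inverse transform is integrable; they include all the squared
   moduli of inverse transforms of f in C_c (for which g^ = f * f~), so that nu
   is unique. *)
Definition is_fourier_transform (R : realType) (gamma : cmeas R)
    (nu : {measure set (plane R) -> \bar R}) : Prop :=
  (forall K : set (R * R), compact K -> (nu K < +oo)%E) /\
  forall g, continuous (g : R * R -> R[i]^o) -> cintegrable (lebesgue2 R) g ->
    Cc (fourier g) ->
    cintegrable nu g /\ cintegral nu g = gamma (fourier g).

Definition is_diffraction (R : realType) (om : cmeas R)
    (nu : {measure set (plane R) -> \bar R}) : Prop :=
  exists gamma : cmeas R,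
    is_autocorrelation om gamma /\ is_fourier_transform gamma nu.

(* Main.v *)
Require Import Defs.
From mathcomp Require Import all_boot all_order all_algebra.
From mathcomp Require Import all_classical all_reals all_analysis.
From mathcomp Require Import measurable_realfun complex.
From mathcomp Require Import zify ring lra.

(** The result is a strong law of large numbers for orthogonal characters,
    which takes the place of a pointwise ergodic theorem.

    Testing [omega_N * tilde omega_N] against a compactly supported [g] gives
    the finite sum, over the differences [d] of lattice points, of [g d] times
    the correlation sum of [w (z + d) * conj (w z)] over the [z] such that [z]
    and [z + d] both lie in the box ([mconv_omega_corr]). For [d = 0] every term
    is [1], and the sum divided by the volume tends to [1]. So the theorem
    amounts to the almost sure vanishing of the normalised correlation sum for
    each of the countably many [d <> 0].

    Fix [d <> 0]. The functions [w |-> w (z + d) * conj (w z)] are characters of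
    the compact group, and distinct [z] give distinct characters: under the
    duality of the shift with [Z[1/6]], [z] corresponds to the number
    [2^z.1 * 3^z.2] (its [weight]) and the character to
    [(weight d - 1) * weight z], while [weight] is injective because [2] and [3]
    are multiplicatively independent. Concretely, an explicit element of the
    group multiplies the product of one character with the conjugate of another
    by [-1], so invariance of the Haar measure makes its integral vanish
    ([pair_corr_integral]). By orthonormality the second moment of a correlation
    sum is its number of terms ([corr_sum_second_moment]), which is [O(N^2)]; after
    division by the square of the volume, [16 N^4], it is summable in [N].
    Hence the normalised sums are almost surely square summable, and in
    particular tend to [0] ([average_sqmod_ae]).

    The diffraction statement is the definition of the Fourier transform at the
    origin: [delta 0] applied to the transform of [g] is the integral of [g]. *)

Set Implicit Arguments.
Unset Strict Implicit.
Unset Printing Implicit Defensive.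
Import Order.TTheory GRing.Theory Num.Theory.
Import numFieldNormedType.Exports.
Local Open Scope classical_set_scope.
Local Open Scope ring_scope.
Local Open Scope complex_scope.

(** * Complex exponentials and rotations of the shift *)

Lemma conjE (R : realType) (x : R[i]) : Num.conj x = complex.Re x -i* complex.Im x.
Proof. by case: x. Qed.

Lemma cisD (R : realType) (a b : R) : cis (a + b) = cis a * cis b.
Proof. by rewrite /cis; simpc; rewrite cosD sinD; congr (_ +i* _); ring. Qed.

Lemma cis0 (R : realType) : cis (0 : R) = 1.
Proof. by rewrite /cis cos0 sin0. Qed.

Lemma cisMn (R : realType) (a : R) n : cis (a *+ n) = cis a ^+ n.
Proof.
by elim: n => [|n IH]; rewrite ?mulr0n ?cis0 // mulrS exprS cisD IH.
Qed.

Lemma conj_cis (R : realType) (a : R) : Num.conj (cis a) = cis (- a).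
Proof. by rewrite conjE /cis cosN sinN. Qed.

Lemma cispi (R : realType) : cis (pi : R) = -1.
Proof. by rewrite /cis cospi sinpi; simpc. Qed.

Lemma norm_cis (R : realType) (a : R) : `|cis a| = 1 :> R[i].
Proof. by rewrite normc_def /= cos2Dsin2 sqrtr1. Qed.

(** The image of a lattice point in [Z[1/6]]: a coordinate [w z] of an element of
    the shift is, formally, [w 0] raised to the power [weight z]. *)
Definition weight (R : realType) (z : int * int) : R := 2 ^ z.1 * 3 ^ z.2.

Lemma weightD (R : realType) (x y : int * int) :
  weight R (x + y) = weight R x * weight R y.
Proof. by rewrite /weight !expfzDr // mulrACA. Qed.

Lemma weight_gt0 (R : realType) x : 0 < weight R x.
Proof. by rewrite mulr_gt0 // exprz_gt0. Qed.

(** Multiplicative independence of [2] and [3]: after clearing denominators,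
    [2 ^ m = 3 ^ n] is impossible by parity unless both exponents vanish. *)
Lemma weight_eq1 (R : realType) x : weight R x = 1 -> x = 0.
Proof.
have nat23 (m n : nat) : (2 ^ m = 3 ^ n)%N -> m = 0 /\ n = 0.
  case: m => [|m] e.
    split=> //; case: n e => // n; rewrite expnS => e.
    by have := expn_gt0 3 n; lia.
  have: odd (2 ^ m.+1) = odd (3 ^ n) by rewrite e.
  by rewrite !oddX /= orbT.
have pos (m n : nat) : (2 : R) ^+ m = 3 ^+ n -> m = 0 /\ n = 0.
  by move=> e; apply/nat23/eqP; rewrite -(eqr_nat R) !natrX e.
have prd (m n : nat) : (2 : R) ^+ m * 3 ^+ n = 1 -> m = 0 /\ n = 0.
  rewrite -!natrX -natrM => /eqP; rewrite pnatr_eq1 muln_eq1.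
  move=> /andP[/eqP e2 /eqP e3]; split.
    by have [] := nat23 m 0%N e2.
  by have [] := nat23 0%N n (esym e3).
have u2 k : (2 : R) ^+ k \is a GRing.unit by rewrite unitfE expf_neq0.
have u3 k : (3 : R) ^+ k \is a GRing.unit by rewrite unitfE expf_neq0.
case: x => [[m|m] [n|n]]; rewrite /weight /= ?NegzE -?exprnN -?exprnP => e.
- by have [-> ->] := prd _ _ e.
- by move/(canRL (mulrVK (u3 _))): e; rewrite mul1r => /pos[].
- by move/(canRL (mulVKr (u2 _))): e; rewrite mulr1 => /esym/pos[].
- move/(congr1 GRing.inv): e; rewrite invrM ?unitrV // !invrK invr1 mulrC.
  by move/prd=> [].
Qed.

Lemma weight_inj (R : realType) : injective (weight R).
Proof.
move=> x y e; apply/eqP; rewrite -subr_eq0; apply/eqP/(@weight_eq1 R).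
by apply: (mulIf (lt0r_neq0 (weight_gt0 R y))); rewrite -weightD subrK mul1r.
Qed.

(** The one-parameter subgroup [t |-> (exp (i t weight z))_z] of the shift. It
    separates the characters that occur below, so invariance under it alone
    determines their integrals. *)
Definition rotation_seq (R : realType) (t : R) (z : int * int) : R[i] :=
  cis (t * weight R z).

Lemma rotation_furst (R : realType) (t : R) : rotation_seq t \in @furst R.
Proof.
apply/mem_set; split=> [z|[a b]]; first exact: norm_cis.
by rewrite /rotation_seq -!cisMn /weight /= !expfzDr // !expr1z; split;
  congr cis; rewrite -mulr_natr; ring.
Qed.

Definition rotation (R : realType) (t : R) : furst_shift R :=
  exist (fun w => w \in @furst R) _ (rotation_furst t).

Lemma rotationN_mul (R : realType) (t : R) (v : furst_shift R) :
  furst_mul (rotation (- t)) (furst_mul (rotation t) v) = v.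
Proof.
apply: val_inj; apply/funext => z /=.
by rewrite /rotation_seq mulrA -cisD mulNr addNr cis0 mul1r.
Qed.

(** * Measurability and the Haar measure *)

Lemma furst_coord_continuous (R : realType) (z : int * int) :
  continuous (fun w : furst_shift R => val w z : R[i]^o).
Proof.
move=> w; apply: (@continuous_comp _ {ptws (int * int)%type -> R[i]^o} _
  (fun w : furst_shift R => val w) (fun f => f z)).
  exact: initial_continuous.
exact: (@proj_continuous (int * int)%type (fun=> R[i]^o) z).
Qed.

Lemma conj_continuous (R : realType) :
  continuous (fun x : R[i]^o => Num.conj (x : R[i]) : R[i]^o).
Proof.
move=> x; apply/(@cvgrPdist_lt _ R[i]^o _ (nbhs (x : R[i]^o)) (nbhs_filter _)) => e e0.
apply: (@filterS _ _ (nbhs_filter (x : R[i]^o)) _ _ _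
  (@cvgr_dist_lt _ R[i]^o _ _ (nbhs_filter (x : R[i]^o)) id x cvg_id e e0)) => y /=.
by rewrite -rmorphB norm_conjC.
Qed.

Lemma Re_continuous (R : realType) :
  continuous (fun x : R[i]^o => complex.Re (x : R[i])).
Proof.
move=> x; apply/(@cvgrPdist_lt _ R _ (nbhs (x : R[i]^o)) (nbhs_filter _)) => e e0.
have e0' : 0 < e%:C by rewrite ltcR.
apply: (@filterS _ _ (nbhs_filter (x : R[i]^o)) _ _ _
  (@cvgr_dist_lt _ R[i]^o _ _ (nbhs_filter (x : R[i]^o)) id x cvg_id _ e0')) => y /=.
move=> /(le_lt_trans (normc_ge_Re _)); rewrite ltcR.
by case: x y {e0'} => a b [c d'].
Qed.

Lemma continuous_borel (R : realType) (f : furst_shift R -> R) :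
  continuous f -> measurable_fun (setT : set (furst_borel R)) f.
Proof.
move=> /continuousP cf; apply: (measurability _ (RGenOpens.measurableE R)).
move=> _ [_ [a [b ->] <-]]; rewrite setTI; apply: sub_sigma_algebra.
exact/cf/interval_open.
Qed.

(** Turns the invariance of the measure on images of sets into invariance on
    preimages, without any measurability of the translation itself. *)
Lemma translate_preimage (R : realType) (t : R) (A : set (furst_borel R)) :
  [set furst_mul (rotation (- t)) v | v in A] =
  (fun v => furst_mul (rotation t) v) @^-1` A.
Proof.
apply/seteqP; split=> [_ [v Av <-]|v Av] /=.
  by have := rotationN_mul (- t) v; rewrite opprK => ->.
by exists (furst_mul (rotation t) v); rewrite ?rotationN_mul.
Qed.

(** Such an [F] and [- F] have the same law under the Haar measure, so the two
    integrals, computed from the laws, agree. *)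
Lemma haar_odd_integral0 (R : realType) (mu : probability (furst_borel R) R)
    (t : R) (F : furst_borel R -> R) :
  is_haar mu -> measurable_fun setT F -> [bounded F w | w in setT] ->
  (forall w, F (furst_mul (rotation t) w) = - F w) ->
  (\int[mu]_w (F w)%:E = 0)%E.
Proof.
move=> haar mF bF odd.
have iF : mu.-integrable setT (EFin \o F).
  apply: measurable_bounded_integrable => //.
  by apply: le_lt_trans (probability_le1 mu measurableT) _; rewrite ltry.
have mN : measurable_fun setT (fun w => - F w) by exact: measurableT_comp.
have iN : mu.-integrable setT (EFin \o (fun w => - F w)).
  have := integrableN iF; apply: eq_integrable => // w _ /=.
have law A : measurable A -> mu (F @^-1` A) = mu ((fun w => - F w) @^-1` A).
  move=> mA; have mFA : measurable (F @^-1` A).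
    by rewrite -[X in measurable X]setTI; exact: mF.
  rewrite -(haar (rotation (- t)) _ mFA) translate_preimage.
  by congr (mu _); apply/funext => w; rewrite /preimage /= odd.
have E : (\int[mu]_w (F w)%:E = \int[mu]_w (- F w)%:E)%E.
  have mid := @EFin_measurable R setT.
  have := integral_pushforward mF mid iF measurableT; rewrite preimage_setT => <-.
  have := integral_pushforward mN mid iN measurableT; rewrite preimage_setT => <-.
  by apply: eq_measure_integral => A mA _; exact: law.
have fF := integrable_fin_num measurableT iF.
have EN : (\int[mu]_w (- F w)%:E = - \int[mu]_w (F w)%:E)%E.
  under eq_integral do rewrite EFinN -mulN1e.
  by rewrite integralZl // mulN1e.
move: E fF; rewrite EN /=.
by case: (\int[mu]_w _)%E => // r [] e _; congr EFin; lra.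
Qed.

(** * Orthogonality of the correlation characters *)

Definition corr (R : realType) (d : int * int) (w : int * int -> R[i])
    (z : int * int) : R[i] := w (z + d) * Num.conj (w z).

Lemma furst_norm1 (R : realType) (w : furst_shift R) z : `|val w z : R[i]| = 1.
Proof. by have /set_mem[+ _] := valP w; exact. Qed.

Lemma norm_corr (R : realType) d (w : furst_shift R) z : `|corr d (val w) z| = 1.
Proof. by rewrite normrM norm_conjC !furst_norm1 mulr1. Qed.

Lemma mulc_continuous (R : realType) (T : topologicalType) (f g : T -> R[i]) :
  continuous (f : T -> R[i]^o) -> continuous (g : T -> R[i]^o) ->
  continuous (fun x => f x * g x : R[i]^o).
Proof. by move=> cf cg x; exact: (@continuousM R[i] T f g x (cf x) (cg x)). Qed.

Lemma conjc_continuous (R : realType) (T : topologicalType) (f : T -> R[i]) :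
  continuous (f : T -> R[i]^o) -> continuous (fun x => Num.conj (f x) : R[i]^o).
Proof.
move=> cf x; apply: (@continuous_comp T R[i]^o R[i]^o f); first exact: cf.
exact: conj_continuous.
Qed.

Lemma corr_continuous (R : realType) d z :
  continuous (fun w : furst_shift R => corr d (val w) z : R[i]^o).
Proof.
apply: (mulc_continuous (f := fun w : furst_shift R => val w (z + d))
  (g := fun w => Num.conj (val w z : R[i]))).
  exact: furst_coord_continuous.
by apply: conjc_continuous; exact: furst_coord_continuous.
Qed.

Definition pair_corr (R : realType) d x y (w : furst_shift R) : R :=
  complex.Re (corr d (val w) x * Num.conj (corr d (val w) y)).

Lemma pair_corr_measurable (R : realType) d x y :
  measurable_fun (setT : set (furst_borel R)) (@pair_corr R d x y).
Proof.
apply: continuous_borel => w.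
apply: (@continuous_comp _ R[i]^o R (fun w : furst_shift R =>
  corr d (val w) x * Num.conj (corr d (val w) y)) (@complex.Re R));
  last exact: Re_continuous.
move: w; apply: (mulc_continuous (f := fun w : furst_shift R => corr d (val w) x)
  (g := fun w => Num.conj (corr d (val w) y))).
  exact: corr_continuous.
by apply: conjc_continuous; exact: corr_continuous.
Qed.

Lemma pair_corr_le1 (R : realType) d x y (w : furst_shift R) :
  `|pair_corr d x y w| <= 1.
Proof.
by rewrite -lecR (le_trans (normc_ge_Re _)) // normrM norm_conjC !norm_corr mulr1.
Qed.

Lemma pair_corr_integrable (R : realType) (mu : probability (furst_borel R) R) d x y :
  mu.-integrable setT (EFin \o (@pair_corr R d x y)).
Proof.
apply: measurable_bounded_integrable => //.
- by apply: le_lt_trans (probability_le1 mu measurableT) _; rewrite ltry.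
- exact: pair_corr_measurable.
- by exists 1; split=> // M M1 w _ /=; rewrite (le_trans (pair_corr_le1 _ _ _ _)) // ltW.
Qed.

Lemma corr_rotation (R : realType) (t : R) d (w : furst_shift R) z :
  corr d (val (furst_mul (rotation t) w)) z =
  cis (t * (weight R d - 1) * weight R z) * corr d (val w) z.
Proof.
rewrite /corr /= /rotation_seq rmorphM /= mulrACA conj_cis -cisD weightD.
by congr (cis _ * _); ring.
Qed.

(** The rotation by [t] multiplies the integrand by
    [cis (t * (weight d - 1) * (weight x - weight y))]; the last two factors are
    nonzero when [d <> 0] and [x <> y], so [t] can be chosen to make this [-1]. *)
Lemma pair_corr_integral (R : realType) (mu : probability (furst_borel R) R) d x y :
  is_haar mu -> d != 0 ->
  (\int[mu]_w (pair_corr d x y w)%:E = (x == y)%:R%:E)%E.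
Proof.
move=> haar d0; case: eqVneq => [<-|xy].
  rewrite (eq_integral (fun=> 1%:E)) => [|w _]; last first.
    by rewrite /pair_corr -normCK norm_corr expr1n.
  by rewrite integral_cst // mul1e; exact: probability_setT.
pose r := (weight R d - 1) * (weight R x - weight R y).
have r0 : r != 0.
  rewrite mulf_neq0 // subr_eq0; last by apply: contraNN xy => /eqP/weight_inj/eqP.
  by apply: contraNN d0 => /eqP/weight_eq1/eqP.
apply: (@haar_odd_integral0 _ _ (pi / r)) => //.
- exact: pair_corr_measurable.
- by exists 1; split=> // M M1 w _ /=; rewrite (le_trans (pair_corr_le1 _ _ _ _)) // ltW.
move=> w; rewrite /pair_corr !corr_rotation rmorphM /= mulrACA conj_cis -cisD.
set a := _ + _; have -> : a = pi.
  rewrite -[RHS](divfK r0) /a; move: (pi / r) => q; rewrite /r; ring.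
rewrite cispi mulN1r; by case: (_ * _).
Qed.

Definition corr_sum (R : realType) d (s : seq (int * int)) (w : furst_shift R) : R[i] :=
  \sum_(z <- s) corr d (val w) z.

(** The squared modulus as an element of [R] rather than of [R[i]], so that it can
    be integrated. *)
Definition sqmod (R : realType) (x : R[i]) : R :=
  complex.Re x ^+ 2 + complex.Im x ^+ 2.

Lemma sqmodE (R : realType) (x : R[i]) : sqmod x = complex.Re (x * Num.conj x).
Proof. by rewrite -normCK -add_Re2_Im2. Qed.

Lemma sqmod_ge0 (R : realType) (x : R[i]) : 0 <= sqmod x.
Proof. by rewrite addr_ge0 ?sqr_ge0. Qed.

Lemma Re_sum (R : realType) (I : Type) (s : seq I) (f : I -> R[i]) :
  complex.Re (\sum_(i <- s) f i) = \sum_(i <- s) complex.Re (f i).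
Proof.
elim: s => [|i s IH]; rewrite ?big_nil // !big_cons -IH.
by case: (f i) => a b; case: (\sum_(_ <- _) _).
Qed.

Lemma sqmod_corr_sum (R : realType) d s (w : furst_shift R) :
  sqmod (corr_sum d s w) = \sum_(x <- s) \sum_(y <- s) pair_corr d x y w.
Proof.
rewrite sqmodE rmorph_sum mulr_suml Re_sum; apply: eq_bigr => x _.
by rewrite mulr_sumr Re_sum.
Qed.

Lemma sqmod_corr_sum_measurable (R : realType) d s :
  measurable_fun (setT : set (furst_borel R)) (fun w => sqmod (@corr_sum R d s w)).
Proof.
rewrite (_ : (fun w => _) = fun w => \sum_(x <- s) \sum_(y <- s) pair_corr d x y w).
  apply: measurable_sum => x; apply: measurable_sum => y; exact: pair_corr_measurable.
by apply/funext => w; exact: sqmod_corr_sum.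
Qed.

Lemma corr_sum_second_moment (R : realType) (mu : probability (furst_borel R) R) d s :
  is_haar mu -> d != 0 -> uniq s ->
  (\int[mu]_w (sqmod (corr_sum d s w))%:E = (size s)%:R%:E)%E.
Proof.
move=> haar d0 us.
under eq_integral do rewrite sqmod_corr_sum -sumEFin.
rewrite integral_sum //; last first.
  move=> x; under eq_fun do rewrite -sumEFin.
  apply: integrable_sum => // y _; exact: pair_corr_integrable.
under eq_bigr => x _.
  under eq_integral do rewrite -sumEFin.
  rewrite integral_sum //; last by move=> y; exact: pair_corr_integrable.
  under eq_bigr do rewrite pair_corr_integral //.
  over.
under eq_bigr do rewrite sumEFin.
rewrite sumEFin; congr EFin; rewrite -sum1_size natr_sum.
apply: eq_big_seq => x xs; rewrite (bigD1_seq x) //= eqxx big1 ?addr0 //.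
by move=> y yx; rewrite eq_sym (negbTE yx).
Qed.

(** The sum of the series of functions has a finite integral, hence is finite
    almost everywhere; each term is bounded by the corresponding tail. *)
Lemma ae_cvg0_of_summable (d : measure_display) (T : measurableType d) (R : realType)
    (mu : {measure set T -> \bar R}) (h : nat -> T -> R) :
  (forall n, measurable_fun setT (h n)) -> (forall n x, 0 <= h n x) ->
  (\sum_(0 <= n <oo) \int[mu]_x (h n x)%:E < +oo)%E ->
  {ae mu, forall x, h n x @[n --> \oo] --> 0}.
Proof.
move=> mh h0 fin.
pose H x := (\sum_(0 <= n <oo) (h n x)%:E)%E.
have mH : measurable_fun setT H.
  apply: ge0_emeasurable_sum => [n x _ _|n _]; first by rewrite lee_fin.
  exact/measurable_EFinP.
have H0 x : (0 <= H x)%E by apply: nneseries_ge0 => n _ _; rewrite lee_fin.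
have iH : mu.-integrable setT H.
  apply/integrableP; split=> //.
  under eq_integral do rewrite gee0_abs //.
  rewrite integral_nneseries // => [n|n x _]; last by rewrite lee_fin.
  exact/measurable_EFinP.
apply: filterS (integrable_ae measurableT iH) => x /(_ I) Hx.
have Hoo : (H x < +oo)%E by rewrite -ge0_fin_numE.
have tail := nneseries_tail_cvg Hoo (fun n _ => h0 n x : (0 <= (h n x)%:E)%E).
suff /fine_cvgP[] : (fun n => (h n x)%:E) @ \oo --> 0%:E by [].
apply: squeeze_cvge tail; last exact: cvg_cst.
apply: nearW => n; rewrite lee_fin h0 /=.
have := @nneseries_lim_ge R (fun k => (h k x)%:E) xpredT n n.+1 (fun k _ _ => h0 k x).
by rewrite big_nat1.
Qed.

(** * Averages over boxes of the lattice *)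

Definition ints (N : nat) : seq int := [seq i%:Z - N%:Z | i <- iota 0 (2 * N).+1].

Definition boxZ (N : nat) : seq (int * int) := [seq (x, y) | x <- ints N, y <- ints N].

Lemma mem_ints N (x : int) : (x \in ints N) = (`|x| <= N)%N.
Proof.
apply/mapP/idP => [[i +]|xN]; first by rewrite mem_iota => iN ->; lia.
by exists (absz (x + N%:Z)); rewrite ?mem_iota; lia.
Qed.

Lemma mem_boxZ N z : (z \in boxZ N) = (`|z.1| <= N)%N && (`|z.2| <= N)%N.
Proof.
rewrite -!mem_ints; apply/allpairsP/andP => [[p [p1 p2 ->]]|[z1 z2]] //.
by exists z; split=> //; case: z {z1 z2}.
Qed.

Lemma uniq_boxZ N : uniq (boxZ N).
Proof.
have ui : uniq (ints N).
  by rewrite map_inj_uniq ?iota_uniq // => i j /eqP; lia.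
by apply: allpairs_uniq => // -[a b] [c e] _ _ /= [-> ->].
Qed.

Lemma size_boxZ N : size (boxZ N) = ((2 * N).+1 ^ 2)%N.
Proof. by rewrite size_allpairs !size_map size_iota. Qed.

(** The [z] of the box for which the pair [(z + d, z)] contributes to
    [omega_N * tilde omega_N]. *)
Definition overlap (d : int * int) N : seq (int * int) :=
  [seq z <- boxZ N | z + d \in boxZ N].

Lemma size_overlap d N : (size (overlap d N) <= (2 * N).+1 ^ 2)%N.
Proof. by rewrite -size_boxZ size_filter count_size. Qed.

Definition vol (R : realType) (N : nat) : R := (2 * N%:R) ^+ 2.

Lemma lebesgue2_box (R : realType) N : lebesgue2 R (@box R N) = (vol R N)%:E.
Proof.
have len : lebesgue_measure (`[- N%:R, N%:R]%classic : set R) = (2 * N%:R)%:E.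
  rewrite lebesgue_measure_itv /= lte_fin.
  case: N => [|N]; first by rewrite mulr0n oppr0 ltxx mulr0.
  by rewrite ifT -?EFinD ?opprK ?mulr_natl ?mulr2n // -subr_gt0 opprK addr_gt0 // ltr0Sn.
pose I := `[- N%:R, N%:R]%classic : set R.
have -> : lebesgue2 R (@box R N) = (lebesgue_measure I * lebesgue_measure I)%E.
  by apply: product_measure1E; exact: measurable_itv.
by rewrite !len -EFinM /vol expr2.
Qed.

(** The right-hand side telescopes, which bounds the series of second moments by
    [2]; at [n = 0] the volume vanishes and its inverse is [0] by convention. *)
Lemma second_moment_bound (R : realType) (n m : nat) : (m <= (2 * n).+1 ^ 2)%N ->
  m%:R * (vol R n)^-2 <= if n is k.+1 then 2 / k.+1%:R - 2 / k.+2%:R else 0.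
Proof.
case: n => [|k] mn; first by rewrite /vol mulr0 expr0n /= expr0n /= invr0 mulr0.
have : (m%:R : R) <= 9 * k.+1%:R ^+ 2.
  rewrite -natrX -natrM ler_nat; apply: leq_trans mn _; nia.
rewrite /vol -[k.+2]addn1 natrD.
have x1 : 1 <= (k.+1%:R : R) by rewrite ler1n.
move: (k.+1%:R) x1 => x x1 mx.
have x0 : 0 < x by lra.
have -> : 2 / x - 2 / (x + 1) = 2 / (x * (x + 1)) by field; lra.
have -> : ((2 * x) ^+ 2) ^- 2 = 1 / (16 * x ^+ 4) by field; lra.
rewrite mulrA mulr1 ler_pdivrMr ?mulr_gt0 ?exprn_gt0 //.
rewrite mulrAC ler_pdivlMr ?mulr_gt0 //; last by lra.
have : m%:R * (x * (x + 1)) <= 9 * x ^+ 2 * (x * (x + 1)).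
  by rewrite ler_wpM2r // mulr_ge0; lra.
move=> /le_trans; apply; nra.
Qed.

(** The second moment of the average over the [n]-th box is at most
    [(2n+1)^2 / (2n)^4], which is summable: no sparse subsequence of boxes and
    no interpolation between them is necessary. *)
Lemma average_sqmod_ae (R : realType) (mu : probability (furst_borel R) R) d :
  is_haar mu -> d != 0 ->
  {ae mu, forall w : furst_shift R,
    sqmod (corr_sum d (overlap d n) w) * (vol R n)^-2 @[n --> \oo] --> 0}.
Proof.
move=> haar d0.
pose h n (w : furst_borel R) := sqmod (corr_sum d (overlap d n) w) * (vol R n)^-2.
apply: (@ae_cvg0_of_summable _ _ _ mu h).
- by move=> n; apply: measurable_funM => //; exact: sqmod_corr_sum_measurable.
- by move=> n w; rewrite mulr_ge0 ?sqmod_ge0 // invr_ge0 sqr_ge0.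
pose b n : R := if n is k.+1 then 2 / k.+1%:R - 2 / k.+2%:R else 0.
have hb n : (\int[mu]_w (h n w)%:E <= (b n)%:E)%E.
  under eq_integral do rewrite /h EFinM.
  rewrite ge0_integralZr //=.
  - rewrite corr_sum_second_moment ?filter_uniq ?uniq_boxZ // -EFinM lee_fin.
    exact/second_moment_bound/size_overlap.
  - by apply/measurable_EFinP; exact: sqmod_corr_sum_measurable.
  - by move=> w _; rewrite lee_fin sqmod_ge0.
  - by rewrite lee_fin invr_ge0 sqr_ge0.
have i0 n : (0 <= \int[mu]_w (h n w)%:E)%E.
  by apply: integral_ge0 => w _; rewrite lee_fin mulr_ge0 ?sqmod_ge0 // invr_ge0 sqr_ge0.
apply: (@le_lt_trans _ _ 2%:E); last exact: ltry.
apply: lime_le; first by apply: is_cvg_nneseries => n _ _.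
apply: nearW => n; apply: (@le_trans _ _ (\sum_(0 <= k < n) (b k)%:E)%E).
  exact: lee_sum.
rewrite sumEFin lee_fin.
case: n => [|n]; first by rewrite big_nil.
suff -> : \sum_(0 <= k < n.+1) b k = 2 - 2 / n.+1%:R.
  by rewrite lerBlDr lerDl divr_ge0.
elim: n => [|n IH]; first by rewrite big_nat1 /= divr1 subrr.
by rewrite big_nat_recr //= IH; ring.
Qed.

(** * Expansion of the autocorrelation *)

Definition pt (R : realType) (z : int * int) : R * R := (z.1%:~R, z.2%:~R).

Lemma ptB (R : realType) x y : pt R (x - y) = pt R x - pt R y.
Proof. by rewrite /pt /= !rmorphB. Qed.

Lemma intr_itv (R : realType) (N : nat) (k : int) :
  (k%:~R \in `[- N%:R, N%:R : R]) = (`|k| <= N)%N.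
Proof.
rewrite in_itv /= -[N%:R]/((N%:Z)%:~R) -rmorphN /= !ler_int.
by apply/idP/idP; lia.
Qed.

Lemma mem_box_pt (R : realType) N z : pt R z \in @box R N = (z \in boxZ N).
Proof.
rewrite mem_boxZ -!(intr_itv R).
by apply/idP/andP => [/set_mem[]//|[z1 z2]]; apply/mem_set.
Qed.

Lemma restr_omega (R : realType) (w : furst_shift R) N (f : R * R -> R[i]) :
  restr (omega w) (@box R N) f = \sum_(z <- boxZ N) (val w z : R[i]) * f (pt R z).
Proof.
rewrite /restr /omega /dirac_comb /delta.
rewrite -(@fsbig_widen _ _ _ _ [set` boxZ N]) //.
  rewrite -fsbig_seq ?uniq_boxZ //; apply: eq_big_seq => z zN.
  by rewrite indicE mem_box_pt zN mul1r.
move=> z [_ /= zN]; rewrite indicE mem_box_pt (negbTE (introN idP zN)).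
by rewrite mul0r mulr0.
Qed.

Lemma mconv_omega (R : realType) (w : furst_shift R) N (g : R * R -> R[i]) :
  mconv (restr (omega w) (@box R N)) (tilde (restr (omega w) (@box R N))) g =
  \sum_(x <- boxZ N) \sum_(y <- boxZ N)
    (val w x : R[i]) * Num.conj (val w y : R[i]) * g (pt R (x - y)).
Proof.
rewrite /mconv restr_omega; apply: eq_bigr => x _.
rewrite /tilde restr_omega rmorph_sum mulr_sumr; apply: eq_bigr => y _.
by rewrite rmorphM /= conjCK mulrA ptB.
Qed.

(** The double sum over pairs of lattice points is regrouped according to their
    difference [d], which only matters in the support of [g]. *)
Lemma mconv_omega_corr (R : realType) (w : furst_shift R) N M (g : R * R -> R[i]) :
  (forall d, d \notin boxZ M -> g (pt R d) = 0) ->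
  mconv (restr (omega w) (@box R N)) (tilde (restr (omega w) (@box R N))) g =
  \sum_(d <- boxZ M) g (pt R d) * corr_sum d (overlap d N) w.
Proof.
move=> g0; rewrite mconv_omega.
pose c x y : R[i] := (val w x : R[i]) * Num.conj (val w y : R[i]).
have split_g (x : int * int) : g (pt R x) = \sum_(d <- boxZ M) g (pt R d) * (x == d)%:R.
  have [xM|xM] := boolP (x \in boxZ M); last first.
    rewrite g0 // big1_seq // => d /= dM.
    by rewrite (_ : (x == d) = false) ?mulr0 //; apply: contraNF xM => /eqP ->.
  rewrite (bigD1_seq x) ?uniq_boxZ //= eqxx mulr1 big1 ?addr0 // => d dx.
  by rewrite eq_sym (negbTE dx) mulr0.
transitivity (\sum_(x <- boxZ N) \sum_(y <- boxZ N) \sum_(d <- boxZ M)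
    g (pt R d) * (c x y * (x - y == d)%:R)).
  apply: eq_bigr => x _; apply: eq_bigr => y _.
  by rewrite split_g mulr_sumr; apply: eq_bigr => d _; rewrite mulrCA.
under eq_bigr do rewrite exchange_big.
rewrite exchange_big; apply: eq_bigr => d _ /=.
rewrite exchange_big /= /corr_sum big_filter mulr_sumr [RHS]big_mkcond /=.
apply: eq_bigr => y _; case: ifPn => yd.
  have ydK : y + d - y = d by rewrite addrAC subrr add0r.
  rewrite (bigD1_seq (y + d)) ?uniq_boxZ //= ydK eqxx mulr1 big1 ?addr0 // => x xy.
  rewrite (_ : (x - y == d) = false) ?mulr0 //.
  by apply: contraNF xy; rewrite subr_eq addrC => /eqP ->.
rewrite big1_seq // => x /= xN; rewrite (_ : (x - y == d) = false) ?mulr0 //.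
by apply: contraNF yd; rewrite subr_eq addrC => /eqP <-.
Qed.

Lemma corr_sum0 (R : realType) (w : furst_shift R) N :
  corr_sum 0 (overlap 0 N) w = ((2 * N).+1 ^ 2)%:R.
Proof.
rewrite /overlap; have -> : [seq z <- boxZ N | z + 0 \in boxZ N] = boxZ N.
  by apply/all_filterP/allP => z zN; rewrite addr0.
rewrite /corr_sum (eq_bigr (fun=> 1)) => [|z _]; last first.
  by rewrite /corr addr0 -normCK furst_norm1 expr1n.
by rewrite big_const_seq count_predT iter_addr addr0 size_boxZ.
Qed.

Lemma sqmodZ (R : realType) (x : R[i]) (r : R) : sqmod (x / r%:C) = sqmod x * r^-2.
Proof.
rewrite -(fmorphV (real_complex R)) /sqmod; case: x => a b /=.
by rewrite !mulr0 subr0 add0r !exprMn -mulrDl exprVn.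
Qed.

Lemma sqmodN (R : realType) (x : R[i]) : sqmod (- x) = sqmod x.
Proof. by rewrite /sqmod; case: x => a b /=; rewrite !sqrrN. Qed.

Lemma cvg_of_sqmod (R : realType) (u : nat -> R[i]) (l : R[i]) :
  sqmod (l - u n) @[n --> \oo] --> 0 -> u n @[n --> \oo] --> (l : R[i]^o).
Proof.
move=> u0; apply/(@cvgrPdist_lt _ R[i]^o) => e e0.
have [r r0 er] : exists2 r : R, 0 < r & e = r%:C.
  move: e0; rewrite ltcE /= => /andP[/eqP i0 r0]; exists (complex.Re e) => //.
  by case: e i0 {r0} => a b /= ->.
have r20 : 0 < r ^+ 2 by rewrite exprn_gt0.
have /cvgrPdist_lt/(_ _ r20) := u0.
apply: filterS => n; rewrite sub0r normrN ger0_norm ?sqmod_ge0 // => h.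
rewrite normc_def er ltcR.
by rewrite -(ger0_norm (ltW r0)) -sqrtr_sqr ltr_sqrt.
Qed.

Lemma cvg_real_complex (R : realType) (u : nat -> R) (l : R) :
  u n @[n --> \oo] --> l -> (u n)%:C @[n --> \oo] --> (l%:C : R[i]^o).
Proof.
move=> ul; apply: cvg_of_sqmod.
rewrite (_ : (fun n => _) = fun n => (l - u n) * (l - u n)); last first.
  by apply/funext => n; rewrite /sqmod /= subr0 expr0n addr0 expr2.
have h : l - u n @[n --> \oo] --> 0.
  by rewrite -[X in _ --> X](subrr l); apply: cvgB => //; exact: cvg_cst.
by rewrite -[X in _ --> X](mulr0 0); exact: cvgM.
Qed.

Lemma cvg_box_density (R : realType) :
  ((2 * n).+1 ^ 2)%:R / vol R n @[n --> \oo] --> (1 : R).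
Proof.
rewrite -cvg_shiftS.
rewrite (_ : (fun n => _) = fun n => (1 + 2^-1 * harmonic n) * (1 + 2^-1 * harmonic n)).
  have h : 1 + 2^-1 * @harmonic R n @[n --> \oo] --> (1 + 2^-1 * 0 : R).
    by apply: cvgD; [exact: cvg_cst|apply: cvgMl_tmp; exact: cvg_harmonic].
  have hh := cvgM h h; rewrite mulr0 addr0 mulr1 in hh; exact: hh.
apply/funext => n; rewrite /vol /harmonic /= natrX -[(2 * n.+1).+1]addn1 natrD natrM.
have : n.+1%:R != 0 :> R by rewrite pnatr_eq0.
by move: (n.+1%:R) => x x0; field.
Qed.

Lemma corr_average_cvg (R : realType) (w : furst_shift R) d :
  (d != 0 ->
    sqmod (corr_sum d (overlap d n) w) * (vol R n)^-2 @[n --> \oo] --> 0) ->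
  corr_sum d (overlap d n) w / (vol R n)%:C @[n --> \oo] --> ((d == 0)%:R : R[i]^o).
Proof.
have [-> _|d0 /(_ isT) h] := eqVneq d 0.
  rewrite (_ : (fun n => _) = fun n => (((2 * n).+1 ^ 2)%:R / vol R n)%:C).
    by apply: (@cvg_real_complex R _ 1); exact: cvg_box_density.
  apply/funext => n; rewrite corr_sum0 [RHS](rmorphM (real_complex R)).
  by rewrite (fmorphV (real_complex R)) (rmorph_nat (real_complex R)).
by apply: cvg_of_sqmod; under eq_fun do rewrite sub0r sqmodN sqmodZ.
Qed.

Lemma cvg_sum_seq (R : realType) (I : Type) (s : seq I) (c : I -> R[i])
    (u : I -> nat -> R[i]) (l : I -> R[i]) :
  (forall i, u i n @[n --> \oo] --> (l i : R[i]^o)) ->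
  \sum_(i <- s) c i * u i n @[n --> \oo] --> (\sum_(i <- s) c i * l i : R[i]^o).
Proof.
move=> ul; elim: s => [|i s IH].
  by under eq_fun do rewrite big_nil; rewrite big_nil; exact: (@cvg_cst R[i]^o).
under eq_fun do rewrite big_cons; rewrite big_cons.
have ci := @cvgZl_tmp _ R[i]^o _ _ eventually_filter (c i) _ _ (ul i).
exact: (@cvgD _ R[i]^o _ _ _ _ _ _ _ ci IH).
Qed.

Lemma Cc_box (R : realType) (g : R * R -> R[i]) : Cc g ->
  exists M, forall d, d \notin boxZ M -> g (pt R d) = 0.
Proof.
move=> [_ /compact_bounded[M [_ bM]]].
have := bM (M + 1); rewrite ltrDl ltr01 => /(_ isT) {}bM.
exists (Num.bound (M + 1)) => d; apply: contraNeq => gd.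
have /bM : closure [set x | g x != 0] (pt R d) by exact: subset_closure.
rewrite /= prod_normE /= ge_max -!intr_norm => /andP[d1 d2].
have M0 : 0 <= M + 1 by apply: le_trans d1; rewrite ler0z.
have Mb := archi_boundP M0.
have := le_lt_trans d1 Mb; have := le_lt_trans d2 Mb.
rewrite -[(Num.bound _)%:R]/((Num.bound (M + 1))%:Z)%:~R !ltr_int mem_boxZ.
move: (Num.bound _) d.1 d.2 => B a b; lia.
Qed.

Lemma delta_radon (R : realType) (x : R * R) : is_radon (delta x).
Proof.
split=> [//|K _]; exists 1 => f s _ _ fs.
by rewrite mul1r; exact: fs.
Qed.

(** Since only finitely many [d] contribute for a given [g], convergence of the
    normalised correlation sums for each [d] separately is enough. *)
Lemma omega_autocorrelation (R : realType) (w : furst_shift R) :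
  (forall d, d != 0 ->
    sqmod (corr_sum d (overlap d n) w) * (vol R n)^-2 @[n --> \oo] --> 0) ->
  is_autocorrelation (omega w) (delta (0 : R * R)).
Proof.
move=> h; split; first exact: delta_radon.
move=> g gC; have [M gM] := Cc_box gC.
rewrite (_ : (fun N => _) = fun N => \sum_(d <- boxZ M)
    g (pt R d) * (corr_sum d (overlap d N) w / (vol R N)%:C)); last first.
  apply/funext => N; rewrite lebesgue2_box (mconv_omega_corr _ _ gM) mulr_suml.
  by apply: eq_bigr => d _; rewrite mulrA.
rewrite (_ : delta 0 g = \sum_(d <- boxZ M) g (pt R d) * (d == 0)%:R).
  by apply: cvg_sum_seq => d; apply: corr_average_cvg; exact: h.
rewrite (bigD1_seq 0) ?uniq_boxZ ?mem_boxZ // eqxx mulr1.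
rewrite big1 => [|d /negbTE ->]; last by rewrite mulr0.
by rewrite /= addr0.
Qed.

(** * Diffraction *)

(** The product measure is an iterated integral, that is, a supremum over simple
    functions below the measure of the sections. The comparison with a box thus
    only needs the sections of [K] to be measurable, and they are closed. *)
Lemma lebesgue2_compact (R : realType) (K : set (R * R)) :
  compact K -> (lebesgue2 R K < +oo)%E.
Proof.
move=> cK; have [M [_ bM]] := compact_bounded cK.
have {}bM : forall x, K x -> `|x| <= M + 1.
  by apply: bM; rewrite ltrDl ltr01.
pose N := Num.bound `|M + 1|.
have KN : K `<=` @box R N.
  move=> x /bM; rewrite /= prod_normE ge_max !ler_norml => /andP[x1 x2].
  have MN : M + 1 <= N%:R.
    exact: le_trans (ler_norm _) (ltW (archi_boundP (normr_ge0 _))).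
  by split; rewrite /= in_itv /=; lra.
have clK : closed K.
  by apply: compact_closed cK; exact: norm_hausdorff.
apply: (@le_lt_trans _ _ (lebesgue2 R (@box R N))); last by rewrite lebesgue2_box ltry.
have sect x : (lebesgue_measure (xsection K x : set R) <=
    lebesgue_measure (xsection (@box R N) x : set R))%E.
  apply: le_measure; rewrite ?inE; last exact: le_xsection.
    apply: closed_measurable; rewrite xsectionE; apply: closed_comp => // y _.
    apply: (@cvg_pair _ _ _ (nbhs y) (nbhs x) (nbhs y) _ _ _ (fun=> x) id).
      exact: cvg_cst.
    exact: cvg_id.
  apply: (@measurable_xsection _ _ (measurableTypeR R) (measurableTypeR R)).
  by apply: measurableX; exact: measurable_itv.
rewrite /lebesgue2 /= /product_measure1 !ge0_integralTE //.
apply: ereal_sup_le => _ [f fK <-]; exists f => // x.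
exact: le_trans (fK x) (sect x).
Qed.

Lemma fourier_at0 (R : realType) (g : R * R -> R[i]) :
  fourier g 0 = cintegral (lebesgue2 R) g.
Proof.
rewrite /fourier; congr cintegral; apply/funext => x.
by rewrite !mul0r addr0 mulr0 oppr0 cis0 mul1r.
Qed.

Lemma delta_fourier (R : realType) :
  is_fourier_transform (delta (0 : R * R)) (lebesgue2 R).
Proof.
split; first exact: lebesgue2_compact.
by move=> g _ ig _; split=> //; rewrite /delta fourier_at0.
Qed.

Theorem theorem7 (R : realType) (mu : probability (furst_borel R) R)
    (mu_haar : is_haar mu) :
  {ae mu, forall w : furst_shift R,
    is_autocorrelation (omega w) (delta (0 : R * R)) /\
    is_diffraction (omega w) (lebesgue2 R)}.
Proof.
(* The countably many differences d are enumerated by their codes. *)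
have : {ae mu, forall w : furst_shift R, forall k : nat,
    if (unpickle k : option (int * int)) is Some d then d != 0 ->
      sqmod (corr_sum d (overlap d n) w) * (vol R n)^-2 @[n --> \oo] --> 0
    else True}.
  apply: ae_foralln => k; case: unpickle => [d|]; last exact: aeW.
  have [->|d0] := eqVneq d 0; first by apply: aeW.
  by apply: negligibleS (average_sqmod_ae mu_haar d0) => w; apply: contra_not => h _.
apply: negligibleS => w; apply: contra_not => hw.
have aw : is_autocorrelation (omega w) (delta (0 : R * R)).
  by apply: omega_autocorrelation => d; have := hw (pickle d); rewrite pickleK.
by split=> //; exists (delta 0); split=> //; exact: delta_fourier.
Qed.
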